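(* Let $u,v$ be two distinct vertices of a simple connected graph $G$ of order $n$. Suppose that $v_{1},v_{2},\ldots,v_{s}$ $(1\leq s\leq d(v))$ are vertices of $N_{G}(v)\setminus N_{G}(u)$, all different from $u$. Let $G'=G-vv_{1}-vv_{2}-\cdots-vv_{s}+uv_{1}+uv_{2}+\cdots+uv_{s}$, and let $f$ be a harmonic eigenfunction associated with $\lambda_{2}(G)$. If $f(u)=f(v)$, then $\lambda_{2}(G)\geq\lambda_{2}(G')$.
   Context: $N_G(x)$ is the set of neighbours of $x$ in $G$ and $d(x)$ its degree. For a simple graph $G$, $A$ is its adjacency matrix, $D$ the diagonal degree matrix, $L=D-A$ its Laplacian and $\mathcal{L}(G)=D^{-1/2}LD^{-1/2}$ its normalized Laplacian, with eigenvalues $0=\lambda_1(G)\le\lambda_2(G)\le\cdots\le\lambda_n(G)$. Functions $f:V(G)\to\mathbb{R}$ are viewed as vectors; $e$ is the all-ones vector and $f\perp De$ means $\sum_x d(x)f(x)=0$. With $R(f)=\frac{\sum_{xy\in E(G)}(f(x)-f(y))^2}{\sum_{x}d(x)f(x)^2}$, one has $\lambda_2(G)=\inf_{f\neq0,\,f\perp De}R(f)$; a harmonic eigenfunction associated with $\lambda_2(G)$ is a nonzero $f\perp De$ with $R(f)=\lambda_2(G)$. *)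

(* Defs.v *)
From mathcomp Require Import all_boot all_order all_algebra.
From mathcomp Require Import reals.
From mathcomp Require Import polyrcf.

Set Implicit Arguments.
Unset Strict Implicit.
Unset Printing Implicit Defensive.

Import Order.TTheory GRing.Theory Num.Theory.
Local Open Scope ring_scope.

Section Graph.
Variable V : finType.
Implicit Types (e : rel V) (u v x y : V) (S : {set V}).

Definition simple_graph e : Prop := symmetric e /\ irreflexive e.

Definition connected_graph e : Prop := forall x y, connect e x y.

Definition nbrs e x : {set V} := [set y | e x y].

Definition deg e x : nat := #|nbrs e x|.

(* Delete, resp. add, all the edges joining v, resp. u, to a vertex of S. *)
Definition del_edges e v S : rel V := fun x y =>
  e x y && ~~ ((x == v) && (y \in S) || (y == v) && (x \in S)).

Definition add_edges e u S : rel V := fun x y =>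
  e x y || ((x == u) && (y \in S) || (y == u) && (x \in S)).

Definition move_edges e v u S : rel V := add_edges (del_edges e v S) u S.

End Graph.

(* The list of eigenvalues in R, in nondecreasing order and repeated according
   to their multiplicity as roots of the characteristic polynomial: [rootsR]
   is the increasing list of the distinct roots. *)
Definition spectrum (R : rcfType) (n : nat) (A : 'M[R]_n) : seq R :=
  flatten [seq nseq (mup x (char_poly A)) x | x <- rootsR (char_poly A)].

Section Spectral.
Variables (R : rcfType) (V : finType).
Implicit Types (e : rel V) (f : {ffun V -> R}).

Definition adjacency e : 'M[R]_#|V| :=
  \matrix_(i, j) (e (enum_val i) (enum_val j))%:R.

Definition degree_mx e : 'M[R]_#|V| :=
  diag_mx (\row_i (deg e (enum_val i))%:R).

Definition laplacian e : 'M[R]_#|V| := degree_mx e - adjacency e.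

(* D^{-1/2}.  Since 0^-1 = 0, the entry of an isolated vertex is 0, which is
   the usual convention for the normalized Laplacian. *)
Definition degree_isqrt_mx e : 'M[R]_#|V| :=
  diag_mx (\row_i (Num.sqrt (deg e (enum_val i))%:R)^-1).

Definition normalized_laplacian e : 'M[R]_#|V| :=
  degree_isqrt_mx e *m laplacian e *m degree_isqrt_mx e.

(* Indices start at 0 in sequences, so index 1 is the second eigenvalue. *)
Definition lambda2 e : R := nth 0 (spectrum (normalized_laplacian e)) 1.

(* Each edge xy occurs as (x, y) and as (y, x) in the double sum, whence the
   factor 1/2. *)
Definition rayleigh e f : R :=
  (2^-1 * \sum_x \sum_(y | e x y) (f x - f y) ^+ 2) /
  (\sum_x (deg e x)%:R * f x ^+ 2).

Definition harmonic_eigenfunction e f : Prop :=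
  [/\ f != 0, \sum_x (deg e x)%:R * f x = 0 & rayleigh e f = lambda2 e].

End Spectral.

(* Main.v *)
(** Since f u = f v, replacing the edges v v_i by u v_i changes neither the
    numerator nor the denominator of the Rayleigh quotient of f, nor the sum of
    the d(x) f(x).  So f remains an admissible test function for G', with quotient
    lambda_2(G).  It bounds lambda_2(G') from above by the Courant-Fischer
    principle applied to the span of D'^{1/2} e and D'^{1/2} f, also when G' is
    disconnected or v is isolated in G'. *)

Require Import Defs.
From mathcomp Require Import all_boot all_order all_algebra.
From mathcomp Require Import reals.
From mathcomp Require Import polyrcf complex ring lra.
Set Implicit Arguments.
Unset Strict Implicit.
Unset Printing Implicit Defensive.
Import Order.TTheory GRing.Theory Num.Theory.
Local Open Scope ring_scope.

(** * Characteristic polynomials and sorted lists of eigenvalues *)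

Lemma char_poly_conj (F : fieldType) (n : nat) (P D : 'M[F]_n) :
  P \in unitmx -> char_poly (invmx P *m D *m P) = char_poly D.
Proof.
move=> Pu; rewrite /char_poly.
have -> : char_poly_mx (invmx P *m D *m P) =
    map_mx polyC (invmx P) *m char_poly_mx D *m map_mx polyC P.
  rewrite /char_poly_mx mulmxBr mulmxBl -!map_mxM /=; congr (_ - _).
  by rewrite scalar_mxC -mulmxA -map_mxM mulVmx // map_mx1 mulmx1.
rewrite !det_mulmx mulrAC -det_mulmx -map_mxM mulVmx //.
by rewrite map_mx1 det1 mul1r.
Qed.

Section Spectrum.
Variable R : rcfType.
Implicit Types (n : nat) (s t : seq R).

Lemma sorted_flatten_nseq (m : R -> nat) t :
  sorted <%R t -> sorted <=%R (flatten [seq nseq (m x) x | x <- t]).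
Proof.
rewrite !(sorted_pairwise lt_trans, sorted_pairwise le_trans).
elim: t => //= x t IH /andP[/allP xt /IH{}IH].
rewrite pairwise_cat IH andbT; apply/andP; split.
  apply/allrelP => y z /nseqP[-> _] /flattenP[_ /mapP[w wt ->]] /nseqP[-> _].
  exact/ltW/xt.
by elim: (m x) => //= k ->; rewrite andbT; apply/allP => y /nseqP[->].
Qed.

Lemma spectrum_sorted n (M : 'M[R]_n) : sorted <=%R (spectrum M).
Proof. exact/sorted_flatten_nseq/sorted_roots. Qed.

(** In both lists, the number of occurrences of x is the multiplicity of x as a root of
    [char_poly M]. *)
Lemma perm_spectrum n (M : 'M[R]_n) s :
  char_poly M = \prod_(x <- s) ('X - x%:P) -> perm_eq (spectrum M) s.
Proof.
move=> Ms; apply/allP => x _ /=; apply/eqP.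
rewrite -[RHS]mu_prod_XsubC -Ms count_flatten -map_comp sumnE big_map.
under eq_bigr => y _ do rewrite /= count_nseq /= mulnbl.
have p0 : char_poly M != 0 by rewrite monic_neq0 ?char_poly_monic.
have Ur : uniq (rootsR (char_poly M)).
  exact/(sorted_uniq lt_trans (@ltxx _ _))/sorted_roots.
rewrite -big_mkcond.
have [xr|xNr] := boolP (x \in rootsR (char_poly M)).
  by rewrite -big_filter filter_pred1_uniq // big_seq1.
rewrite big1_seq => [|y /andP[/eqP -> ]]; last by rewrite (negPf xNr).
rewrite mupNroot //; apply: contra xNr => rx.
by rewrite -(roots_on_rootsR p0) /= rx.
Qed.

(** From index [k] on, every entry is at least the [k]-th one, hence exceeds [l]; only the first [k]
    entries can be counted. *)
Lemma count_le_sorted s k (l : R) :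
  sorted <=%R s -> (k < size s)%N -> l < nth 0 s k ->
  (count (fun x => (x <= l)%R) s <= k)%N.
Proof.
move=> ss ks lk; rewrite -(cat_take_drop k s) count_cat.
rewrite [X in (_ + X)%N](_ : _ = 0)%N ?addn0.
  by rewrite (leq_trans (count_size _ _)) // size_take ks.
apply/eqP; rewrite -leqn0 leqNgt -has_count; apply/hasPn => /= x.
case/(nthP 0) => i; rewrite size_drop nth_drop => ilt <-.
rewrite -ltNge (lt_le_trans lk) //.
apply: (sorted_leq_nth le_trans lexx) => //; rewrite ?inE ?leq_addr //.
by rewrite -ltn_subRL.
Qed.

End Spectrum.

(** * Real symmetric matrices: diagonalization and a min-max bound *)

Section SpectralTheorem.
Local Open Scope sesquilinear_scope.
Variable R : rcfType.
Local Notation toC := (real_complex R).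

Lemma conjC_real_complex (x : R) : (toC x)^* = toC x.
Proof. by apply/CrealP; rewrite complex_real. Qed.

(** Over [R[i]] the matrix is Hermitian, hence unitarily diagonalizable with real eigenvalues. The
    factorization of the characteristic polynomial is obtained there and descends to [R] by
    injectivity of the embedding. *)
Lemma real_symmetric_spectral n (M : 'M[R]_n) : M^T = M ->
  exists (P : 'M[R[i]]_n) (d : 'rV[R]_n),
    [/\ P \is unitarymx,
        map_mx toC M = P^t* *m diag_mx (map_mx toC d) *m P
      & char_poly M = \prod_(x <- [seq d 0 i | i <- enum 'I_n]) ('X - x%:P)].
Proof.
move=> Msym; set A := map_mx toC M.
have Aherm : A \is hermsymmx.
  apply: realsym_hermsym.
    by apply/is_hermitianmxP; rewrite expr0 scale1r map_mx_id // /A map_trmx Msym.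
  by apply/mxOverP => i j; rewrite mxE complex_real.
have /orthomx_spectralP := hermitian_normalmx Aherm.
have /mxOverP dreal := hermitian_spectral_diag_real Aherm.
have := spectral_unitarymx A.
move: (spectralmx A) (spectral_diag A) dreal => P D Dreal Pu AE.
have DE : D = map_mx toC (map_mx (@complex.Re R) D).
  by apply/rowP => j; rewrite !mxE RRe_real.
exists P, (map_mx (@complex.Re R) D); split => //.
  by rewrite -DE -invmx_unitary.
apply: (map_poly_inj (real_complex R)).
rewrite map_char_poly -/A AE char_poly_conj ?unitarymx_unit //.
rewrite char_poly_trig ?diag_mx_is_trig // big_map big_enum /=.
rewrite rmorph_prod; apply: eq_bigr => i _.
by rewrite /= map_polyXsubC {1}DE !mxE eqxx mulr1n.
Qed.

(** Write x = a + ib with a, b in the real row space of [U]. For a real symmetric N the cross terms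
    cancel, so x N x* = a N a^T + b N b^T; this is used for N = M and N = 1, and the real bound is
    added up over a and b. *)
Lemma real_complex_form_le n (M : 'M[R]_n) k (U : 'M[R]_(k, n)) (l : R) :
  M^T = M ->
  (forall c : 'rV_k, let x := c *m U in
     (x *m M *m x^T) 0 0 <= l * (x *m x^T) 0 0) ->
  forall c : 'rV[R[i]]_k, let x := c *m map_mx toC U in
    (x *m map_mx toC M *m x^t*) 0 0 <= toC l * (x *m x^t*) 0 0.
Proof.
move=> Msym le_form c; set x := c *m _; cbv zeta.
pose a := map_mx (@complex.Re R) c *m U; pose b := map_mx (@complex.Im R) c *m U.
have xE : x = map_mx toC a + 'i%C *: map_mx toC b.
  rewrite !map_mxM scalemxAl -mulmxDl; congr (_ *m _).
  by apply/rowP => j; rewrite !mxE -complexE.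
have xcE : x^t* = map_mx toC a^T - 'i%C *: map_mx toC b^T.
  apply/colP => j; rewrite xE !mxE rmorphD rmorphM /= !conjC_real_complex.
  by rewrite -mulNr; congr (_ + _ * _); apply/eqP; rewrite eq_complex /= oppr0 !eqxx.
have /= := le_form (map_mx (@complex.Im R) c); rewrite -/b.
have /= := le_form (map_mx (@complex.Re R) c); rewrite -/a.
move: a b x xE xcE => a b x xE xcE le_a le_b.
have formE (N : 'M[R]_n) : N^T = N -> (x *m map_mx toC N *m x^t*) 0 0 =
    toC ((a *m N *m a^T) 0 0 + (b *m N *m b^T) 0 0).
  move=> Nsym; have abE : (b *m N *m a^T) 0 0 = (a *m N *m b^T) 0 0.
    suff -> : b *m N *m a^T = (a *m N *m b^T)^T by rewrite mxE.
    by rewrite !trmx_mul trmxK Nsym mulmxA.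
  have i2 : 'i%C * 'i%C = -1 :> R[i] by rewrite -expr2 sqr_i.
  rewrite xcE xE mulmxDl mulmxBr !mulmxDl -!scalemxAl -!scalemxAr -!map_mxM.
  move: (a *m _ *m _) (b *m _ *m _) (a *m _ *m _) (b *m _ *m _) abE.
  move=> aa bb ab ba E.
  rewrite !mxE E rmorphD /=.
  ring: i2.
have := formE _ Msym; have := formE 1%:M (trmx1 _ _).
by rewrite map_mx1 !mulmx1 => -> ->; rewrite -rmorphM lecR mulrDr lerD.
Qed.


(* Min-max upper bound.  If all but at most k eigenvalues exceed l, some nonzero
   vector of the (k+1)-dimensional row space of U has no component along the
   eigenvectors of eigenvalue at most l.  The spectral theorem being available
   over R[i] only, that vector has to be taken complex. *)
Theorem nth_spectrum_le n (M : 'M[R]_n) k (U : 'M[R]_(k.+1, n)) (l : R) :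
  M^T = M -> row_free U ->
  (forall c : 'rV_k.+1, let x := c *m U in
     (x *m M *m x^T) 0 0 <= l * (x *m x^T) 0 0) ->
  nth 0 (spectrum M) k <= l.
Proof.
move=> Msym Ufree le_form.
have [P [d [Pu AE chE]]] := real_symmetric_spectral Msym.
have PtP : P^t* *m P = 1%:M by rewrite -invmx_unitary // mulVmx ?unitarymx_unit.
have sd := perm_spectrum chE.
rewrite leNgt; apply/negP => lt_l.
pose I := [set i | d 0 i <= l].
have cardI : (#|I| <= k)%N.
  have -> : #|I| = count (fun x => x <= l) (spectrum M).
    rewrite (seq.permP sd) count_map cardE /enum_mem size_filter -enumT.
    rewrite [in RHS](@eq_filter _ _ predT) // filter_predT.
    by apply: eq_count => i; rewrite /= inE.
  apply: count_le_sorted lt_l; first exact: spectrum_sorted.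
  (* The k + 1 independent rows of [U] force k < n, so [nth] does not fall back on its default
     value. *)
  rewrite (perm_size sd) size_map size_enum_ord.
  by rewrite -(eqP Ufree) rank_leq_col.
(* The coordinates of the rows of [U] along the eigenvectors in [I]: k + 1 rows and at most k
   columns, hence a nonzero left kernel. *)
pose W := colsub (fun j : 'I_#|I| => enum_val j) (map_mx toC U *m P^t*).
have /rowV0Pn[c /sub_kermxP cW c0] : kermx W != 0.
  rewrite -mxrank_eq0 mxrank_ker subn_eq0 -ltnNge ltnS.
  exact: leq_trans (rank_leq_col _) cardI.
have := real_complex_form_le Msym le_form c; cbv zeta.
have : c *m map_mx toC U != 0.
  by rewrite mulmx_free_eq0 // /row_free mxrank_map.
have : (c *m map_mx toC U) *m P^t* = c *m (map_mx toC U *m P^t*).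
  by rewrite mulmxA.
move: (c *m map_mx toC U) => x; set y := x *m P^t* => yE x0.
have yI i : d 0 i <= l -> y 0 i = 0.
  move=> dl; have iI : i \in I by rewrite inE.
  have := congr1 (fun N : 'rV_#|I| => N 0 (enum_rank_in iI i)) cW.
  rewrite mxE [RHS]mxE yE => <-.
  by rewrite mxE; apply: eq_bigr => j _; rewrite [W j _]mxE enum_rankK_in.
have -> : x *m map_mx toC M *m x^t* = y *m diag_mx (map_mx toC d) *m y^t*.
  by rewrite AE /y trmx_mul map_mxM trmxCK !mulmxA.
have -> : x *m x^t* = y *m y^t*.
  by rewrite /y trmx_mul map_mxM trmxCK -mulmxA (mulmxA _ P) PtP mul1mx.
have xE : x = y *m P by rewrite -mulmxA PtP mulmx1.
move: y xE yI {yE} => y xE yI.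
rewrite mul_mx_diag !mxE mulr_sumr -subr_le0 -sumrB => le0.
(* In the eigenbasis the assumed bound says that the [F i] have sum at most 0. Each is nonnegative,
   as y vanishes where d_i is at most l; so all are 0, which also kills y where d_i > l and gives x
   = 0. *)
pose F i := (toC (d 0 i) - toC l) * `|y 0 i| ^+ 2.
have FE : \sum_i F i <= 0.
  apply: le_trans le0; rewrite le_eqVlt; apply/orP; left; apply/eqP.
  apply: eq_bigr => i _; rewrite !mxE /F normCK; ring.
have F0 i : 0 <= F i.
  rewrite /F; have [/yI ->|/ltW dl] := leP (d 0 i) l.
    by rewrite normr0 expr0n mulr0.
  by rewrite mulr_ge0 ?exprn_ge0 // subr_ge0 lecR.
have Fz : \sum_i F i = 0 by apply/le_anti; rewrite FE sumr_ge0.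
have y0 : y = 0.
  apply/rowP => i; rewrite mxE.
  have [/yI //|dl] := leP (d 0 i) l.
  have /eqP : F i = 0 by apply: (psumr_eq0P _ Fz).
  rewrite mulf_eq0 subr_eq0 (inj_eq (@complexI _)) (gt_eqF dl) /=.
  by rewrite sqrf_eq0 normr_eq0 => /eqP.
by case/eqP: x0; rewrite xE y0 mul0mx.
Qed.

End SpectralTheorem.


(** * Rayleigh quotients of the normalized Laplacian *)

Section RayleighBound.
Variables (R : rcfType) (V : finType).
Implicit Types (e : rel V) (g : V -> R).

(** Turns degree-weighted sums into sums over adjacent pairs, the shape in which the effect of
    moving edges is computed. *)
Lemma sum_deg e g :
  \sum_x (deg e x)%:R * g x = \sum_x \sum_(y | e x y) g x.
Proof.
apply: eq_bigr => x _; rewrite sumr_const mulr_natl; congr (_ *+ _).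
by apply: eq_card => y; rewrite inE.
Qed.

Lemma deg_gt0 e x y : e x y -> (0 < deg e x)%N.
Proof. by move=> exy; apply/card_gt0P; exists y; rewrite inE. Qed.

Lemma enum_val_sum (F : V -> R) : \sum_(i < #|V|) F (enum_val i) = \sum_x F x.
Proof.
rewrite (reindex (@enum_val V predT)) //=.
by exists (fun x => enum_rank_in (erefl : x \in predT) x) => x _;
  rewrite ?enum_valK_in ?enum_rankK_in.
Qed.

(** The vector D^{1/2} g, the substitution relating the quadratic form of the normalized Laplacian
    to [rayleigh]. *)
Definition sqrt_deg_row e g : 'rV[R]_#|V| :=
  \row_i (Num.sqrt (deg e (enum_val i))%:R * g (enum_val i)).

Lemma sqrt_deg_row_norm e g :
  (sqrt_deg_row e g *m (sqrt_deg_row e g)^T) 0 0 =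
  \sum_x (deg e x)%:R * g x ^+ 2.
Proof.
rewrite mxE -enum_val_sum; apply: eq_bigr => i _.
by rewrite !mxE mulrACA -!expr2 sqr_sqrtr ?ler0n.
Qed.

(** Exchanging the endpoints shows that g(x)^2 and g(y)^2 have the same sum over adjacent pairs. The
    sum of squares is therefore twice the difference of the degree form and the adjacency form. *)
Lemma laplacian_form e g : symmetric e ->
  let z := \row_i g (enum_val i) in
  (z *m laplacian R e *m z^T) 0 0 =
  2^-1 * \sum_x \sum_(y | e x y) (g x - g y) ^+ 2.
Proof.
move=> e_sym z.
have -> : \sum_x \sum_(y | e x y) (g x - g y) ^+ 2 =
    2 * (\sum_x \sum_(y | e x y) (g x ^+ 2 - g x * g y)).
  have sw : \sum_x \sum_(y | e x y) g x ^+ 2 = \sum_x \sum_(y | e x y) g y ^+ 2.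
    rewrite (exchange_big_dep predT) //=; apply: eq_bigr => x _.
    by apply: eq_bigl => y; rewrite e_sym.
  rewrite mulr_sumr; under [RHS]eq_bigr => x _ do rewrite mulr_sumr.
  apply/eqP; rewrite -subr_eq0; apply/eqP.
  transitivity (\sum_x \sum_(y | e x y) g y ^+ 2 - \sum_x \sum_(y | e x y) g x ^+ 2).
    rewrite -!sumrB; apply: eq_bigr => x _; rewrite -!sumrB.
    by apply: eq_bigr => y _; ring.
  by rewrite sw subrr.
rewrite mulKf ?pnatr_eq0 // /laplacian mulmxBr mulmxBl !mxE.
transitivity (\sum_x (deg e x)%:R * g x ^+ 2 - \sum_x \sum_(y | e x y) g x * g y).
  rewrite -!enum_val_sum; congr (_ - _).
    rewrite mul_mx_diag; apply: eq_bigr => i _; rewrite !mxE; ring.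
  under eq_bigr => i _ do rewrite !mxE mulr_suml.
  rewrite exchange_big; apply: eq_bigr => i _.
  rewrite [RHS]big_mkcond -enum_val_sum.
  apply: eq_bigr => j _; rewrite !mxE.
  by case: (e _ _); rewrite ?mulr1 ?mulr0 ?mul0r.
rewrite sum_deg -sumrB; by apply: eq_bigr => x _; rewrite -sumrB.
Qed.

(* Vertices of degree 0 are sent to 0 by [degree_isqrt_mx], but they do not
   contribute to the sum over the edges. *)
Lemma normalized_laplacian_form e g : symmetric e ->
  let z := sqrt_deg_row e g in
  (z *m normalized_laplacian R e *m z^T) 0 0 =
  2^-1 * \sum_x \sum_(y | e x y) (g x - g y) ^+ 2.
Proof.
move=> e_sym z; pose h x := if (0 < deg e x)%N then g x else 0.
have zD : z *m degree_isqrt_mx R e = \row_i h (enum_val i).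
  rewrite mul_mx_diag; apply/rowP => i; rewrite !mxE /h.
  have [d0|] := ltnP; last by rewrite leqn0 => /eqP ->; rewrite sqrtr0 !mul0r.
  by rewrite mulrAC mulfV ?mul1r // sqrtr_eq0 -ltNge ltr0n.
have -> : z *m normalized_laplacian R e *m z^T =
    (z *m degree_isqrt_mx R e) *m laplacian R e *m (z *m degree_isqrt_mx R e)^T.
  by rewrite trmx_mul tr_diag_mx /normalized_laplacian !mulmxA.
rewrite zD laplacian_form //; congr (_ * _).
apply: eq_bigr => x _; apply: eq_bigr => y exy.
by rewrite /h (deg_gt0 exy) (deg_gt0 (y := x)) // e_sym.
Qed.

Lemma tr_normalized_laplacian e :
  symmetric e -> (normalized_laplacian R e)^T = normalized_laplacian R e.
Proof.
move=> e_sym; rewrite /normalized_laplacian !trmx_mul !tr_diag_mx mulmxA.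
congr (_ *m _ *m _); rewrite /laplacian linearB /= tr_diag_mx; congr (_ - _).
by apply/matrixP => i j; rewrite !mxE e_sym.
Qed.

(** Min-max with k = 1 on the span of D^{1/2} 1 and D^{1/2} f. For c0 + c1 f the edge sum is c1^2
    times that of f, while by orthogonality the squared norm is c0^2 m + c1^2 N; the constant part
    can only lower the quotient. *)
Theorem lambda2_le_rayleigh e (f : {ffun V -> R}) :
  symmetric e ->
  \sum_x (deg e x)%:R * f x = 0 ->
  0 < \sum_x (deg e x)%:R * f x ^+ 2 ->
  lambda2 R e <= rayleigh e f.
Proof.
move=> e_sym f_perp f_gt0.
pose U := \matrix_(k < 2) sqrt_deg_row e (if k == 0 then fun=> 1 else f).
have UE (c : 'rV_2) : c *m U = sqrt_deg_row e (fun x => c 0 0 + c 0 1 * f x).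
  apply/rowP => i; rewrite mxE big_ord_recl big_ord1 !mxE /=.
  rewrite (_ : lift ord0 ord0 = 1); last exact: val_inj.
  ring.
pose N := \sum_x (deg e x)%:R * f x ^+ 2.
pose m := \sum_x (deg e x)%:R : R.
have normE (c : 'rV_2) : ((c *m U) *m (c *m U)^T) 0 0 = c 0 0 ^+ 2 * m + c 0 1 ^+ 2 * N.
  rewrite UE sqrt_deg_row_norm.
  transitivity (c 0 0 ^+ 2 * m + c 0 1 ^+ 2 * N
      + 2 * c 0 0 * c 0 1 * (\sum_x (deg e x)%:R * f x)); last first.
    by rewrite f_perp mulr0 addr0.
  rewrite !mulr_sumr -!big_split; apply: eq_bigr => x _ /=; ring.
(* A zero total degree would make every degree, and with them the denominator [N], vanish. *)
have m_gt0 : 0 < m.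
  rewrite lt_neqAle sumr_ge0 // andbT eq_sym; apply/negP => /eqP m0.
  move: f_gt0; rewrite big1 ?ltxx // => x _.
  by rewrite (psumr_eq0P _ m0) ?mul0r.
have E_ge0 : 0 <= 2^-1 * \sum_x \sum_(y | e x y) (f x - f y) ^+ 2.
  rewrite mulr_ge0 ?invr_ge0 ?ler0n // sumr_ge0 // => x _.
  by rewrite sumr_ge0 // => y _; rewrite sqr_ge0.
apply: (@nth_spectrum_le _ _ _ 1 U).
- exact: tr_normalized_laplacian.
- rewrite -kermx_eq0; apply/rowV0P => c /sub_kermxP cU0.
  have := normE c; rewrite cU0 mul0mx mxE => /esym/eqP.
  rewrite paddr_eq0; try by rewrite mulr_ge0 ?sqr_ge0 ?ltW.
  rewrite !mulf_eq0 (gt_eqF m_gt0) (gt_eqF f_gt0) !orbF !orbb => /andP[/eqP c0 /eqP c1].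
  apply/rowP => i; rewrite mxE.
  by case: i => [[|[|//]] i2]; [rewrite -[RHS]c0 | rewrite -[RHS]c1];
    congr (c _ _); apply: val_inj.
- move=> c; cbv zeta; rewrite normE UE normalized_laplacian_form //.
  have -> : \sum_x \sum_(y | e x y)
      (c 0 0 + c 0 1 * f x - (c 0 0 + c 0 1 * f y)) ^+ 2 =
      c 0 1 ^+ 2 * \sum_x \sum_(y | e x y) (f x - f y) ^+ 2.
    rewrite mulr_sumr; apply: eq_bigr => x _.
    by rewrite mulr_sumr; apply: eq_bigr => y _; ring.
  rewrite mulrDr [X in _ <= _ + X](_ : _ =
      2^-1 * (c 0 1 ^+ 2 * \sum_x \sum_(y | e x y) (f x - f y) ^+ 2)).
    rewrite lerDr; apply: mulr_ge0; first exact: divr_ge0 E_ge0 (ltW f_gt0).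
    by rewrite mulr_ge0 ?sqr_ge0 ?ltW.
  by rewrite /rayleigh -/N; field; rewrite gt_eqF.
Qed.

End RayleighBound.

(** * Sums over adjacent pairs before and after moving the edges *)

Section MoveEdges.
Variables (V : finType) (e : rel V) (u v : V) (S : {set V}).
Hypotheses (e_sym : symmetric e) (eirr : irreflexive e).

Lemma move_edges_sym : symmetric (move_edges e v u S).
Proof.
move=> x y; rewrite /move_edges /add_edges /del_edges e_sym.
by rewrite (orbC ((x == v) && _)) (orbC ((x == u) && _)).
Qed.

Hypotheses (uv : u != v) (uS : u \notin S) (Suv : S \subset nbrs e v :\: nbrs e u).

Lemma sum_pred1_andb (R : comNzRingType) (w : V) (b : bool) (F : V -> R) :
  \sum_x ((x == w) && b)%:R * F x = b%:R * F w.
Proof.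
rewrite (bigD1 w) //= eqxx big1 ?addr0 // => x /negPf ->.
by rewrite mul0r.
Qed.

(** The move adds the pairs joining u to S and removes those joining v to S. Since G does not
    distinguish u from v in either argument, the two contributions cancel. *)
Lemma sum_move_edges (R : comNzRingType) (G : V -> V -> R) :
  G u =1 G v -> (forall x, G x u = G x v) ->
  \sum_x \sum_(y | move_edges e v u S x y) G x y =
  \sum_x \sum_(y | e x y) G x y.
Proof.
move=> Guv Gvu.
have eSv y : y \in S -> e v y.
  by move/(subsetP Suv); rewrite !inE => /andP[].
have eSu y : y \in S -> e u y = false.
  by move/(subsetP Suv); rewrite !inE => /andP[/negbTE].
have vS : v \notin S by apply/negP => /eSv; rewrite eirr.
pose one w x y : R := ((x == w) && (y \in S))%:R * G x y.
pose two w x y : R := ((y == w) && (x \in S))%:R * G x y.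
(* [one] and [two] record the two orientations of a moved edge. The balance is exact because S
   contains neither u nor v, each pair removed was an edge, and each pair added was not. *)
have split x y : (if move_edges e v u S x y then G x y else 0) =
    (if e x y then G x y else 0)
    + ((one u x y - one v x y) + (two u x y - two v x y)).
  rewrite /one /two /move_edges /add_edges /del_edges.
  have [->|xu] := eqVneq x u; have [->|yu] := eqVneq y u;
    rewrite ?(negPf uv) ?(negPf uS) ?eirr /= ?andbF ?orbF ?andbT.
  - ring.
  - case yS: (y \in S); first by rewrite eSu //=; ring.
    by rewrite ?andbF ?orbF; case: (e u y) => /=; ring.
  - case xS: (x \in S); first by rewrite e_sym eSu //=; ring.
    by rewrite ?andbF ?orbF; case: (e x u) => /=; ring.
  have [->|xv] := eqVneq x v; have [->|yv] := eqVneq y v;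
    rewrite ?(negPf vS) ?eirr /= ?andbF ?orbF ?andbT.
  - ring.
  - case yS: (y \in S); first by rewrite eSv //=; ring.
    by case: (e v y) => /=; ring.
  - case xS: (x \in S); first by rewrite e_sym eSv //=; ring.
    by case: (e x v) => /=; ring.
  by case: (e x y) => /=; ring.
under eq_bigr => x _.
  rewrite big_mkcond; under eq_bigr => y _ do rewrite split.
  rewrite !big_split /= !sumrN -big_mkcond; over.
rewrite !big_split /= !sumrN.
have -> : \sum_x \sum_y one u x y = \sum_x \sum_y one v x y.
  rewrite exchange_big [RHS]exchange_big /=; apply: eq_bigr => y _.
  by rewrite !sum_pred1_andb Guv.
have -> : \sum_x \sum_y two u x y = \sum_x \sum_y two v x y.
  by apply: eq_bigr => x _; rewrite !sum_pred1_andb Gvu.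
by rewrite !subrr !addr0.
Qed.

End MoveEdges.

Theorem theorem3p6 (R : realType) (V : finType) (e : rel V) (u v : V)
    (s : nat) (w : s.-tuple V) (f : {ffun V -> R}) :
  simple_graph e -> connected_graph e -> u != v ->
  (1 <= s <= deg e v)%N -> uniq w ->
  (forall i : 'I_s, tnth w i \in nbrs e v :\: nbrs e u) ->
  (forall i : 'I_s, tnth w i != u) ->
  harmonic_eigenfunction e f -> f u = f v ->
  lambda2 R (move_edges e v u [set x in w]) <= lambda2 R e.
Proof.
move=> [e_sym e_irr] e_conn uv _ _ w_nbr w_u [f0 f_perp <-] fuv.
set S := [set x in w]; set e' := move_edges e v u S.
have uS : u \notin S.
  by rewrite inE; apply/negP => /tnthP[i wi]; case/eqP: (w_u i).
have Suv : S \subset nbrs e v :\: nbrs e u.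
  by apply/subsetP => x; rewrite inE => /tnthP[i ->].
have sum_e' := sum_move_edges e_sym e_irr uv uS Suv.
(* Taking h to be the square preserves the denominator; h = [id] preserves orthogonality to the
   degree vector. *)
have sum_deg' (h : R -> R) :
    \sum_x (deg e' x)%:R * h (f x) = \sum_x (deg e x)%:R * h (f x).
  by rewrite !sum_deg (sum_e' _ (fun x _ => h (f x))) // => y; rewrite fuv.
have f_norm := sum_deg' (fun t => t ^+ 2); rewrite /= in f_norm.
have -> : rayleigh e f = rayleigh e' f.
  rewrite /rayleigh f_norm.
  by rewrite (sum_e' _ (fun x y => (f x - f y) ^+ 2)) // => y; rewrite fuv.
apply: lambda2_le_rayleigh; first exact: move_edges_sym.
  by rewrite (sum_deg' id).
(* As u and v differ, x has a vertex distinct from it, and a path to that vertex starts with an edge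
   at x. *)
have deg_pos x : (0 < deg e x)%N.
  have [y xy] : exists y, x != y.
    by have [->|] := eqVneq x u; [exists v | exists u].
  have /connectP[[|z p] /= path_xy yE] := e_conn x y.
    by rewrite yE eqxx in xy.
  by apply: (deg_gt0 (y := z)); case/andP: path_xy.
have [x fx] : exists x, f x != 0.
  apply/existsP; apply: contraNT f0 => /existsPn f0.
  by apply/eqP/ffunP => x; rewrite ffunE; apply/eqP; rewrite -[_ == _]negbK f0.
(* Positivity is checked with the degrees of G, which are all positive, whereas v may be isolated in
   G'. *)
rewrite f_norm (bigD1 x) //= ltr_wpDr //.
  by rewrite sumr_ge0 // => y _; rewrite mulr_ge0 ?sqr_ge0.
by rewrite mulr_gt0 ?ltr0n // exprn_even_gt0.
Qed.
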